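(* For every $\epsilon>0$ there exists a family of instances of maximizing a monotone submodular (in fact coverage) function under cardinality constraint $k$ with the following property. Suppose each item is sent to at least one and at most $C\le\sqrt{\epsilon m/2}$ machines chosen uniformly at random among $m$ machines, and the algorithm on each machine may return at most $k$ items. If the per-machine algorithm is $\mathsf{Greedy}$ or any local search algorithm, then it is at most a $(\frac12+\frac1k+\epsilon)$-approximate composable core-set; that is, $\mathbb E[f_k(\bigcup_{i=1}^m\mathsf{ALG}(T_i))]\le(\frac12+\frac1k+\epsilon)\max_{|S|\le k}f(S)$, where $T_i$ is the set of items sent to machine $i$.
   Context: For a finite ground set $\mathbb N$ and $f:2^{\mathbb N}\to\mathbb R_{\ge0}$, $f_k(S)=\max_{S'\subseteq S,|S'|\le k}f(S')$. A coverage function: items are subsets of a universe $\mathbb U$ and $f(S)=|\bigcup_{A\in S}A|$. $\mathsf{Greedy}$ on a set $T$ starts from $\emptyset$ and repeatedly adds an item of maximum marginal value $f(S\cup\{x\})-f(S)$, returning at most $k$ items. A local search algorithm here means an algorithm returning a locally optimum solution of size at most $k$ (one that cannot be improved by exchanging a selected item for an unselected one). *)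

(* Defs.v *)
From HB Require Import structures.
From mathcomp Require Import all_boot all_order all_algebra.
From mathcomp Require Import reals.

Set Implicit Arguments.
Unset Strict Implicit.
Unset Printing Implicit Defensive.

Import Order.TTheory GRing.Theory Num.Theory.
Local Open Scope ring_scope.

Section SetFunctions.
Variables (R : realType) (N : finType).
Implicit Types (f : {set N} -> R) (S T : {set N}).

Definition monotone_setfun f := forall S T, S \subset T -> f S <= f T.

Definition submodular f :=
  forall S T, f (S :|: T) + f (S :&: T) <= f S + f T.

(* Items are subsets of the universe [U]: the injection [A] identifies each
   item with the subset it is, so distinct items are distinct subsets. *)
Definition coverage f :=
  exists (U : finType) (A : N -> {set U}),
    injective A /\ forall S, f S = #|\bigcup_(x in S) A x|%:R.

(* The default value [f set0] is attained by the admissible set [set0], so the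
   iterated maximum is the maximum over the subsets of [S] of size <= [k]. *)
Definition fmax f (k : nat) S : R :=
  \big[Num.max/f set0]_(S' : {set N} | (S' \subset S) && (#|S'| <= k)%N) f S'.

Definition marginal f S x : R := f (x |: S) - f S.

Inductive greedy_run f T : {set N} -> Prop :=
| greedy_start : greedy_run f T set0
| greedy_step S x :
    greedy_run f T S -> x \in T :\: S ->
    (forall y, y \in T :\: S -> marginal f S y <= marginal f S x) ->
    greedy_run f T (x |: S).

(* Ties are broken arbitrarily.  The run ends when [k] items are selected or
   when no item of [T] is left; it may also end earlier, but only once no
   remaining item has a positive marginal value. *)
Definition greedy_output f (k : nat) T S :=
  [/\ greedy_run f T S, (#|S| <= k)%N &
      #|S| = k \/ forall y, y \in T :\: S -> marginal f S y <= 0].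

Definition locally_optimal f (k : nat) T S :=
  [/\ S \subset T, (#|S| <= k)%N &
      forall x y, x \in S -> y \in T :\: S -> f (y |: (S :\ x)) <= f S].

Definition is_greedy f k (ALG : {set N} -> {set N}) :=
  forall T, greedy_output f k T (ALG T).

Definition is_local_search f k (ALG : {set N} -> {set N}) :=
  forall T, locally_optimal f k T (ALG T).

End SetFunctions.

Section RandomAssignment.
Variables (R : realType) (N : finType) (m : nat).

(* [a x] is the set of machines receiving the item [x]. *)
Definition assignment := {ffun N -> {set 'I_m}}.

Definition received (a : assignment) (i : 'I_m) : {set N} :=
  [set x | i \in a x].

Definition assignments (c : N -> nat) : {set assignment} :=
  [set a : assignment | [forall x, #|a x| == c x]].

(* Each item [x] is sent, independently of the others, to a uniformly random
   set of [c x] machines.  As [assignments c] is a product over the items, this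
   is the uniform distribution on it, so the expectation is a plain average. *)
Definition expectation_assign (c : N -> nat) (g : assignment -> R) : R :=
  (\sum_(a in assignments c) g a) / #|assignments c|%:R.

End RandomAssignment.

(* Main.v *)
(* The universe consists of k blocks of M points and of k - 1 further disjoint sets
   of M - 2 points, the good items.  One item "big" is the union of all the blocks,
   and deleting one point from a block yields M decoys for it.  The optimum, "big"
   with the good items, has value kM + (k - 1)(M - 2), twice the value kM of "big",
   up to a factor 1 + O(1/k).  On a machine that has not received "big" but has
   received a decoy of every block, both greedy and local search prefer a decoy of
   an untouched block, worth M - 1, to a good item, worth M - 2, so no good item is
   returned.  A good item meets "big" on some machine with probability at most
   C^2/m <= eps/2, and for M large some machine misses all the decoys of some block
   with probability at most k m (1 - 1/m)^M <= eps/2.  Hence only a fraction eps of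
   the good items is expected to survive, and without good items the value is at
   most kM. *)

Require Import Defs.
From HB Require Import structures.
From mathcomp Require Import all_boot all_order all_algebra.
From mathcomp Require Import reals.
From mathcomp Require Import zify ring lra.

Set Implicit Arguments.
Unset Strict Implicit.
Unset Printing Implicit Defensive.

Import Order.TTheory GRing.Theory Num.Theory.
Local Open Scope ring_scope.

(** * Averages over random assignments, factored over the items *)

Section Expectation.
Variables (R : realType) (N : finType) (m : nat) (c : N -> nat).
Implicit Types (g h : assignment N m -> R) (P : N -> {set 'I_m} -> bool).

Lemma expectation_le g h : (forall a, g a <= h a) ->
  expectation_assign c g <= expectation_assign c h.
Proof. by move=> gh; rewrite ler_wpM2r ?invr_ge0 ?ler0n ?ler_sum. Qed.

Lemma expectationD g h :
  expectation_assign c (fun a => g a + h a) =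
  expectation_assign c g + expectation_assign c h.
Proof. by rewrite /expectation_assign big_split mulrDl. Qed.

Lemma expectationZ (r : R) g :
  expectation_assign c (fun a => r * g a) = r * expectation_assign c g.
Proof. by rewrite /expectation_assign -mulr_sumr mulrA. Qed.

Lemma expectation_sum (I : finType) (G : I -> assignment N m -> R) :
  expectation_assign c (fun a => \sum_i G i a) =
  \sum_i expectation_assign c (G i).
Proof. by rewrite /expectation_assign exchange_big mulr_suml. Qed.

(** Conditions imposed on each item separately cut out a product of finite sets, so the count
    factors. *)
Lemma card_assignments_event P :
  #|[set a in assignments m c | [forall x, P x (a x)]]| =
  (\prod_x #|[set s : {set 'I_m} | #|s| == c x & P x s]|)%N.
Proof.
pose F x := mem [set s : {set 'I_m} | #|s| == c x & P x s].
transitivity #|(family F : simpl_pred {ffun N -> {set 'I_m}})|.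
  apply: eq_card => a; rewrite !inE; apply/andP/forallP => [[]|aF].
    by move=> /forallP ca /forallP Pa x; rewrite !inE ca Pa.
  by split; apply/forallP => x; have:= aF x; rewrite !inE => /andP[].
by rewrite card_family foldrE big_image.
Qed.

Lemma card_assignments : #|assignments m c| = (\prod_x 'C(m, c x))%N.
Proof.
have := card_assignments_event (fun _ _ => true).
rewrite (_ : [set _ | _] = assignments m c) => [->|]; last first.
  by apply/setP=> a; rewrite inE andb_idr // => _; apply/forallP.
apply: eq_bigr => x _; rewrite -[in RHS](card_ord m) -card_draws.
by apply: eq_card => s; rewrite !inE andbT.
Qed.

Hypothesis c_le : forall x, (c x <= m)%N.

Let bin_neq0 x : 'C(m, c x)%:R != 0 :> R.
Proof. by rewrite pnatr_eq0 -lt0n bin_gt0. Qed.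

(** By [c_le] every binomial factor is positive, so there are assignments to average over and their
    number cancels. *)
Lemma expectation_cst (r : R) : expectation_assign c (fun _ : assignment N m => r) = r.
Proof.
rewrite /expectation_assign sumr_const card_assignments -[r *+ _]mulr_natr mulfK //.
by rewrite natr_prod; apply/prodf_neq0 => x _.
Qed.

(** This is the independence of the items: favourable and total counts are products over the same
    index set. *)
Lemma expectation_indep P :
  expectation_assign c (fun a : assignment N m => [forall x, P x (a x)]%:R) =
  \prod_x (#|[set s : {set 'I_m} | #|s| == c x & P x s]|%:R / 'C(m, c x)%:R)
  :> R.
Proof.
rewrite /expectation_assign big_split /= prodfV -!natr_prod.
rewrite -card_assignments_event card_assignments; congr (_ / _).
rewrite -natr_sum -sum1_card big_mkcond [in RHS]big_mkcond; congr _%:R.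
by apply: eq_bigr => a _; rewrite !inE; case: [forall x, #|_| == _]; case: [forall x, P _ _].
Qed.

(** The receiving sets avoiding [i] are the [c x]-subsets of the other [m - 1] machines, and [m *
    'C(m - 1, c x) = (m - c x) * 'C(m, c x)]. *)
Lemma prob_miss (i : 'I_m) x :
  #|[set s : {set 'I_m} | #|s| == c x & i \notin s]|%:R / 'C(m, c x)%:R
  = 1 - (c x)%:R / m%:R :> R.
Proof.
have m_neq0 : m%:R != 0 :> R by rewrite pnatr_eq0 -lt0n (leq_ltn_trans _ (ltn_ord i)).
have -> : #|[set s : {set 'I_m} | #|s| == c x & i \notin s]| = 'C(m.-1, c x).
  rewrite -[in RHS](card_ord m) -(cardsC1 i) -cards_draws; apply: eq_card => s.
  by rewrite !inE -setCS setCK sub1set inE andbC.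
have /(congr1 (fun j => j%:R : R)) := mul_bin_down m (c x).
rewrite !natrM natrB // => e.
apply: (mulIf (bin_neq0 x)); rewrite divfK //; apply: (mulfI m_neq0).
by rewrite e; field.
Qed.

Lemma prob_hit (i : 'I_m) x :
  #|[set s : {set 'I_m} | #|s| == c x & i \in s]|%:R / 'C(m, c x)%:R
  = (c x)%:R / m%:R :> R.
Proof.
have /(congr1 (fun j => j%:R / 'C(m, c x)%:R : R)) :
    (#|[set s : {set 'I_m} | #|s| == c x & i \in s]| +
     #|[set s : {set 'I_m} | #|s| == c x & i \notin s]| = 'C(m, c x))%N.
  rewrite -[in RHS](card_ord m) -card_draws.
  rewrite -[RHS](cardsID [set s : {set 'I_m} | i \in s]); congr (_ + _)%N.
    by apply: eq_card => s; rewrite !inE.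
  by apply: eq_card => s; rewrite !inE andbC.
by rewrite natrD mulrDl prob_miss divff //; lra.
Qed.

Lemma prob_true x :
  #|[set s : {set 'I_m} | #|s| == c x & true]|%:R / 'C(m, c x)%:R = 1 :> R.
Proof.
rewrite (_ : #|_| = 'C(m, c x)) ?divff // -[in RHS](card_ord m) -card_draws.
by apply: eq_card => s; rewrite !inE andbT.
Qed.

Lemma prob_all_miss (i : 'I_m) (X : {set N}) :
  expectation_assign c (fun a : assignment N m => [forall x in X, i \notin a x]%:R) =
  \prod_(x in X) (1 - (c x)%:R / m%:R) :> R.
Proof.
rewrite (expectation_indep (fun x s => (x \in X) ==> (i \notin s))) [RHS]big_mkcond.
by apply: eq_bigr => x _; case: ifP => _; rewrite ?prob_miss ?prob_true.
Qed.

Lemma prob_all_hit (i : 'I_m) (X : {set N}) :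
  expectation_assign c (fun a : assignment N m => [forall x in X, i \in a x]%:R) =
  \prod_(x in X) ((c x)%:R / m%:R) :> R.
Proof.
rewrite (expectation_indep (fun x s => (x \in X) ==> (i \in s))) [RHS]big_mkcond.
by apply: eq_bigr => x _; case: ifP => _; rewrite ?prob_hit ?prob_true.
Qed.

End Expectation.

(** * Coverage functions and their marginal values *)

Section Coverage.
Variables (R : realType) (N U : finType) (A : N -> {set U}).
Implicit Types S T : {set N}.

Lemma bigcup_subset S T : S \subset T ->
  \bigcup_(x in S) A x \subset \bigcup_(x in T) A x.
Proof.
by move=> /subsetP sST; apply/bigcupsP => x /sST xT; apply: bigcup_sup.
Qed.

Definition coverage_fun S : R := #|\bigcup_(x in S) A x|%:R.

Lemma coverage_fun_monotone : monotone_setfun coverage_fun.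
Proof. by move=> S T sST; rewrite ler_nat subset_leq_card // bigcup_subset. Qed.

Lemma coverage_fun_submodular : submodular coverage_fun.
Proof.
move=> S T; rewrite -!natrD ler_nat bigcup_setU -[leqRHS]cardsUI leq_add2l.
by rewrite subset_leq_card // subsetI !bigcup_subset ?subsetIl ?subsetIr.
Qed.

Lemma marginal_coverage S x :
  marginal coverage_fun S x = #|A x :\: \bigcup_(y in S) A y|%:R.
Proof.
rewrite /marginal /coverage_fun bigcup_setU big_set1; set B := \bigcup_(y in S) _.
rewrite -(cardsID B (A x :|: B)) (setIidPr (subsetUr _ _)) setDUl setDv setU0.
by rewrite natrD addrC addKr.
Qed.

End Coverage.

Lemma greedy_run_sub (R : realType) (N : finType) (f : {set N} -> R) T S :
  greedy_run f T S -> S \subset T.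
Proof.
elim=> [|{}S x _ sST /setDP[xT _] _]; first exact: sub0set.
by rewrite subUset sub1set xT.
Qed.

(** * The instance, and what greedy and local search return on it *)

Section Instance.
Variables (R : realType) (q n : nat).

(** Here [k = q.+1] and [M = n.+3]. The first summand holds the private points of the good items,
    the second the blocks. *)
Definition point : finType := ('I_q * 'I_n.+1 + 'I_q.+1 * 'I_n.+3)%type.
Definition item : finType := ('I_q + option ('I_q.+1 * 'I_n.+3))%type.

Definition good (i : 'I_q) : item := inl i.
Definition big : item := inr None.
Definition decoy (g : 'I_q.+1) (j : 'I_n.+3) : item := inr (Some (g, j)).

(* Distinct items must be distinct sets, so a block cannot simply be repeated:
   the decoys of the block [g] are the complements in it of single points. *)
Definition covers (x : item) (u : point) : bool :=
  match x, u with
  | inl i, inl (i', _) => i == i'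
  | inr None, inr _ => true
  | inr (Some (g, j)), inr (g', j') => (g == g') && (j != j')
  | _, _ => false
  end.

Definition points (x : item) : {set point} := [set u | covers x u].

Local Notation f := (coverage_fun R points).

Lemma points_inj : injective points.
Proof.
(* A block has more than one point, so a decoy is never empty; [other] yields a point separating it
   from good items and from decoys of other blocks. *)
have other (j : 'I_n.+3) : exists j', j != j'.
  by exists (if j == ord0 then ord_max else ord0); case: (eqVneq j ord0) => [->|].
move=> x y /setP exy.
case: x exy => [i|[[g j]|]] exy; case: y exy => [i'|[[g' j']|]] exy //.
- by have := exy (inl (i, ord0)); rewrite !inE /= eqxx => /esym/eqP->.
- by have := exy (inl (i, ord0)); rewrite !inE /= eqxx.
- by have := exy (inl (i, ord0)); rewrite !inE /= eqxx.
- by have [l jl] := other j; have := exy (inr (g, l)); rewrite !inE /= eqxx jl.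
- have [l jl] := other j; have := exy (inr (g, l)).
  rewrite !inE /= eqxx jl => /esym/andP[/eqP eg _]; subst g'.
  (* Both decoys now lie in the same block, and the point missing from the first must be the one
     missing from the second. *)
  by have := exy (inr (g, j)); rewrite !inE /= !eqxx /= => /esym/negbFE/eqP->.
- by have := exy (inr (g, j)); rewrite !inE /= !eqxx.
- by have := exy (inl (i', ord0)); rewrite !inE /= eqxx.
- by have := exy (inr (g', j')); rewrite !inE /= !eqxx.
Qed.

Lemma card_points_good i : #|points (good i)| = n.+1.
Proof.
rewrite (_ : points _ = [set inl (i, j) | j : 'I_n.+1]).
  by rewrite card_imset ?card_ord // => j j' [].
apply/setP=> u; rewrite inE; apply/idP/imsetP => [|[j _ ->]] /=; last exact: eqxx.
by case: u => [[i' j] /eqP<-|//]; exists j.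
Qed.

Lemma card_points_decoy g j : #|points (decoy g j)| = n.+2.
Proof.
rewrite (_ : points _ = [set inr (g, l) | l in [set~ j]]).
  by rewrite card_imset ?cardsC1 ?card_ord // => l l' [].
apply/setP=> u; rewrite inE; apply/idP/imsetP => [|[l + ->]] /=.
  case: u => [//|[g' l] /andP[/eqP<- jl]].
  by exists l; rewrite // !inE eq_sym.
by rewrite !inE eqxx eq_sym.
Qed.

Lemma card_points_big : #|points big| = (q.+1 * n.+3)%N.
Proof.
rewrite (_ : points _ = [set inr p | p : 'I_q.+1 * 'I_n.+3]).
  by rewrite card_imset ?card_prod ?card_ord // => p p' [].
apply/setP=> u; rewrite inE; apply/idP/imsetP => [|[p _ ->]] //.
by case: u => [//|p] _; exists p.
Qed.

Lemma marginal_good S i : marginal f S (good i) <= n.+1%:R.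
Proof.
by rewrite marginal_coverage ler_nat -(card_points_good i) subset_leq_card ?subsetDl.
Qed.

(** Points of the block [g] are covered only by [big] and by decoys of [g], so the whole decoy is
    new. *)
Lemma marginal_decoy (S : {set item}) g j :
    big \notin S -> (forall l, decoy g l \notin S) ->
  marginal f S (decoy g j) = n.+2%:R.
Proof.
move=> bS gS; rewrite marginal_coverage -(card_points_decoy g j).
congr _%:R; apply: eq_card => u; rewrite [LHS]inE andbC.
case: (boolP (u \in points _)) => //= ug.
apply/bigcupP => -[y yS]; rewrite inE => yu.
move: ug; rewrite inE; case: u yu => [//|[g' l]] yu /= /andP[/eqP eg _].
case: y yS yu => [//|[[g'' l']|]] yS; last by rewrite yS in bS.
by move=> /andP[/eqP eg' _]; have := gS l'; rewrite eg -eg' yS.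
Qed.

(** Pigeonhole: otherwise one decoy of [S] chosen in each block would give [q.+1] distinct elements
    of [S]. *)
Lemma free_group (S : {set item}) : (#|S| <= q)%N ->
  exists g, forall j, decoy g j \notin S.
Proof.
move=> Sq.
have [/existsP[g /forallP gP]|] := boolP [exists g, forall j, decoy g j \notin S].
  by exists g.
move=> /existsPn nS.
have hS g : exists j, decoy g j \in S.
  by have /forallPn[j /negPn] := nS g; exists j.
pose r g := decoy g (xchoose (hS g)).
have : (q.+1 <= #|S|)%N.
  rewrite -[q.+1]card_ord -cardsT -(@card_imset _ _ r); last by move=> g g' [].
  by apply/subset_leq_card/subsetP => _ /imsetP[g _ ->]; apply: (xchooseP (hS g)).
by rewrite ltnNge Sq.
Qed.

Definition blinded (T : {set item}) :=
  (big \notin T) && [forall g, exists j, decoy g j \in T].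

Lemma blinded_decoy (T S : {set item}) :
    blinded T -> S \subset T -> (#|S| <= q)%N ->
  exists2 d, d \in T :\: S & marginal f S d = n.+2%:R.
Proof.
move=> /andP[bT /forallP hT] sST /free_group[g gS].
have /existsP[j dT] := hT g.
exists (decoy g j); first by rewrite inE gS.
by apply: marginal_decoy => //; apply: contraNN bT => /(subsetP sST).
Qed.

(* While fewer than [q.+1] items are selected some block is untouched, and a decoy
   of that block has a marginal value larger than any good item can have. *)
Lemma greedy_blinded T S i : blinded T -> greedy_run f T S ->
  (#|S| <= q.+1)%N -> good i \notin S.
Proof.
move=> hT; elim=> [|{}S x run IH /setDP[xT xS] xmax]; first by rewrite inE.
rewrite cardsU1 xS ltnS => Sq; rewrite !inE negb_or IH 1?ltnW // andbT.
have [d dTS dm] := blinded_decoy hT (greedy_run_sub run) Sq.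
have := xmax d dTS; rewrite dm; apply: contraTneq => <-.
by rewrite -ltNge (le_lt_trans (marginal_good _ _)) // ltr_nat.
Qed.

(** Removing a selected good item leaves at most [q] items, hence an untouched block; exchanging the
    good item for a decoy of that block strictly improves the value. *)
Lemma local_blinded T S i : blinded T -> locally_optimal f q.+1 T S ->
  good i \notin S.
Proof.
move=> hT [sST cS opt]; apply/negP => iS.
have sDT : S :\ good i \subset T := subset_trans (subsetDl _ _) sST.
have cD : (#|S :\ good i| <= q)%N by rewrite (cardsD1 (good i)) iS in cS.
have [d /setDP[dT dS] dm] := blinded_decoy hT sDT cD.
(* The removed item itself lies in [T :\: (S :\ good i)]; the marginal value of [d] is too large for
   a good item. *)
have dNi : d != good i.
  apply: contra_eqN dm => /eqP->; rewrite lt_eqF //.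
  by rewrite (le_lt_trans (marginal_good _ _)) // ltr_nat.
have dTS : d \in T :\: S by move: dS; rewrite !inE dNi dT => /= ->.
have := opt _ _ iS dTS; apply/negP; rewrite -ltNge -[S in f S](setD1K iS).
rewrite -(ltrD2r (- f (S :\ good i))) -/(marginal _ _ _) -/(marginal _ _ _) dm.
by rewrite (le_lt_trans (marginal_good _ _)) // ltr_nat.
Qed.

Lemma le_fmax (S T : {set item}) k : S \subset T -> (#|S| <= k)%N ->
  f S <= fmax f k T.
Proof.
by move=> sST cS; apply: (le_bigmax_cond (f set0) f); rewrite sST.
Qed.

(** Decoys cover nothing outside [big], so any selection covers at most the blocks and the private
    points of the good items in [T], whatever [k] is. *)
Lemma fmax_upper k (T : {set item}) :
  fmax f k T <= (q.+1 * n.+3)%:R + n.+1%:R * \sum_i (good i \in T)%:R.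
Proof.
have bound (S : {set item}) : S \subset T ->
    f S <= (q.+1 * n.+3)%:R + n.+1%:R * \sum_i (good i \in T)%:R.
  move=> sST; rewrite -natr_sum -natrM -natrD ler_nat -card_points_big.
  apply: (@leq_trans #|points big :|: \bigcup_(i | good i \in T) points (good i)|).
    apply/subset_leq_card/bigcupsP => x xS; apply/subsetP => u xu.
    rewrite inE; apply/orP.
    case: x xS xu => [i|[[g j]|]] xS xu; [right|left|left].
    - by apply/bigcupP; exists i => //; apply: (subsetP sST).
    - by move: xu; rewrite !inE; case: u.
    - by move: xu; rewrite !inE; case: u.
  apply: leq_trans (leq_card_setU _ _) _; rewrite leq_add2l.
  rewrite big_distrr big_mkcond; elim/big_ind2: _ => [|B b B' b' Bb Bb'|i _].
  - by rewrite cards0.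
  - by rewrite (leq_trans (leq_card_setU _ _)) // leq_add.
  - by case: (good i \in T); rewrite ?cards0 //= muln1 card_points_good.
by apply: bigmax_le => [|S /andP[sST _]]; apply: bound => //; apply: sub0set.
Qed.

Lemma fmax_lower : (q.+1 * n.+3 + q * n.+1)%:R <= fmax f q.+1 setT.
Proof.
(* [big] with all [q] good items has exactly [q.+1] elements and covers the whole universe. *)
pose O := big |: [set good i | i : 'I_q].
have cO : (#|O| <= q.+1)%N.
  by rewrite cardsU1 card_imset ?card_ord => [|i j []//]; case: (_ \notin _).
apply: le_trans (le_fmax (subsetT O) cO); rewrite ler_nat.
rewrite (_ : \bigcup_(x in O) points x = setT).
  by rewrite cardsT card_sum !card_prod !card_ord addnC.
apply/eqP; rewrite -subTset; apply/subsetP => u _; apply/bigcupP.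
case: (u) => [[i j]|p].
  exists (good i); first by rewrite setU1r // imset_f.
  by rewrite /points in_set /= eqxx.
by exists big; rewrite ?setU11 // /points in_set.
Qed.

End Instance.

(** * Survival of good items under random assignment *)

Section RandomizedInstance.
Variables (R : realType) (q n m C : nat) (c : item q n -> nat).
Variable ALG : {set item q n} -> {set item q n}.
Local Notation f := (coverage_fun R (@points q n)).

Hypothesis m_gt0 : (0 < m)%N.
Hypothesis c_bounds : forall x, (1 <= c x <= C)%N && (c x <= m)%N.
Hypothesis ALG_sub : forall T, ALG T \subset T.
Hypothesis ALG_blinded : forall T i, blinded T -> good n i \notin ALG T.

Let c_le x : (c x <= m)%N. Proof. by have /andP[] := c_bounds x. Qed.

Let m_gt0R : 0 < m%:R :> R. Proof. by rewrite ltr0n. Qed.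

(** Union bound: a machine returning a good item has received it and is not blinded, so it also
    holds [big] or lacks every decoy of some block. *)
Lemma good_selected_cases (a : assignment (item q n) m) i :
  (good n i \in \bigcup_(l < m) ALG (received a l))%:R <=
  \sum_(l < m) [forall x in [set big q n; good n i], l \in a x]%:R +
  \sum_(l < m) \sum_(g < q.+1)
     [forall x in [set decoy g j | j : 'I_n.+3], l \notin a x]%:R :> R.
Proof.
have [/bigcupP[l _ il]|_] := boolP (good n i \in _); last first.
  by rewrite addr_ge0 ?sumr_ge0 // => l _; rewrite sumr_ge0.
have := contraL (ALG_blinded i (T := received a l)) il.
rewrite negb_and negbK => /orP[bl|/forallPn[g /existsPn gl]].
  rewrite -[leLHS]addr0 lerD ?sumr_ge0 //; last first.
    by move=> ? _; rewrite sumr_ge0.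
  rewrite (bigD1 l) //= (_ : [forall x in _, l \in a x]) ?lerDl ?sumr_ge0 //.
  apply/forall_inP => x; rewrite !inE => /orP[/eqP->|/eqP->].
    by move: bl; rewrite inE.
  by have := subsetP (ALG_sub _) _ il; rewrite inE.
rewrite -[leLHS]add0r lerD ?sumr_ge0 // (bigD1 l) //= (bigD1 g) //=.
rewrite (_ : [forall x in _, l \notin a x]); last first.
  by apply/forall_inP => _ /imsetP[j _ ->]; have := gl j; rewrite inE.
by rewrite -addrA lerDl addr_ge0 ?sumr_ge0 // => ? _; rewrite sumr_ge0.
Qed.

(** The two items are placed independently, each reaching [l] with probability at most [C / m]. *)
Lemma prob_collision i (l : 'I_m) :
  expectation_assign c
    (fun a => [forall x in [set big q n; good n i], l \in a x]%:R) <=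
  (C%:R / m%:R) ^+ 2 :> R.
Proof.
rewrite prob_all_hit // big_setU1 ?inE //= big_set1 expr2.
by rewrite ler_pM ?divr_ge0 ?ler0n // ler_pM2r ?invr_gt0 // ler_nat;
   have /andP[/andP[]] := c_bounds (big q n); have /andP[/andP[]] := c_bounds (good n i).
Qed.

(** Since [1 <= c y], each decoy misses [l] with probability at most [1 - 1/m]; the power is then
    bounded by a rational expression, which makes the later choice of [M] explicit. *)
Lemma prob_group_missed g (l : 'I_m) :
  expectation_assign c
    (fun a => [forall x in [set decoy g j | j : 'I_n.+3], l \notin a x]%:R) <=
  m%:R / n.+3%:R :> R.
Proof.
rewrite prob_all_miss //; set x : R := m%:R^-1.
have x_gt0 : 0 < x by rewrite invr_gt0.
have x_le1 : x <= 1 by rewrite invf_le1 // ler1n.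
apply: (@le_trans _ _ ((1 - x) ^+ n.+3)).
  have cardg : #|[set decoy g j | j : 'I_n.+3]| = n.+3.
    by rewrite card_imset ?card_ord // => j j' [].
  rewrite -[X in _ ^+ X]cardg -prodr_const; apply: ler_prod => y _.
  have /andP[/andP[cy1 _] cym] := c_bounds y.
  rewrite subr_ge0 ler_pdivrMr // mul1r ler_nat cym lerD2l lerN2.
  by rewrite ler_peMl ?(ltW x_gt0) ?ler1n.
(* [(1 - x)^M (1 + M x) <= ((1 - x) (1 + x))^M <= 1] *)
have bernoulli j : 1 + x *+ j <= (1 + x) ^+ j.
  elim: j => [|j IH]; first by rewrite addr0.
  rewrite exprS mulrS; apply: le_trans (ler_wpM2l _ IH); last by lra.
  have : 0 <= x * (x *+ j) by rewrite mulr_ge0 ?mulrn_wge0 ?ltW.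
  by lra.
rewrite -invf_div -[leRHS]mul1r ler_pdivlMr ?divr_gt0 ?ltr0n //.
apply: (@le_trans _ _ (((1 - x) * (1 + x)) ^+ n.+3)); last first.
  by rewrite exprn_ile1 //; nra.
rewrite exprMn ler_wpM2l ?exprn_ge0 ?subr_ge0 //.
apply: le_trans (bernoulli _); rewrite -[x *+ _]mulr_natl.
by rewrite lerDr.
Qed.

(** By linearity the upper bound on the value reduces to the survival probability of a single good
    item, summed over [q] of them. *)
Lemma expected_core_set_value k :
  expectation_assign c (fun a : assignment (item q n) m =>
    fmax f k (\bigcup_(l < m) ALG (received a l))) <=
  (q.+1 * n.+3)%:R +
  n.+1%:R * (q%:R * (C%:R ^+ 2 / m%:R + m%:R * (q.+1%:R * (m%:R / n.+3%:R)))).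
Proof.
apply: le_trans (expectation_le c (fun a => fmax_upper R k _)) _.
rewrite expectationD expectation_cst // lerD2l expectationZ ler_wpM2l ?ler0n //.
rewrite expectation_sum.
have bound i : expectation_assign c (fun a : assignment (item q n) m =>
      (good n i \in \bigcup_(l < m) ALG (received a l))%:R) <=
    C%:R ^+ 2 / m%:R + m%:R * (q.+1%:R * (m%:R / n.+3%:R)) :> R.
  apply: le_trans (expectation_le c (good_selected_cases ^~ i)) _.
  rewrite expectationD !expectation_sum; apply: lerD.
    apply: le_trans (ler_sum _ (fun l _ => prob_collision i l)) _.
    rewrite sumr_const card_ord -mulr_natr le_eqVlt; apply/orP; left.
    by apply/eqP; field; rewrite gt_eqF.
  apply: (@le_trans _ _ (\sum_(l < m) \sum_(g < q.+1) (m%:R / n.+3%:R))).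
    apply: ler_sum => l _; rewrite expectation_sum; apply: ler_sum => g _.
    exact: prob_group_missed.
  by rewrite !sumr_const !card_ord -[leLHS]mulr_natl -[_ / _ *+ _]mulr_natl.
apply: le_trans (ler_sum _ (fun i _ => bound i)) _.
by rewrite sumr_const card_ord -[leLHS]mulr_natl.
Qed.

End RandomizedInstance.

(** * Choice of the block size, and the approximation ratio *)

Theorem theorem3 (R : realType) (eps : R) (heps : 0 < eps)
    (k m : nat) (hk : (0 < k)%N) (hm : (0 < m)%N) :
  exists (N : finType) (f : {set N} -> R),
    [/\ monotone_setfun f, submodular f, coverage f,
        0 < fmax f k [set: N] &
        forall (C : nat) (c : N -> nat),
          C%:R <= Num.sqrt (eps * m%:R / 2) ->
          (forall x, (1 <= c x <= C)%N && (c x <= m)%N) ->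
          forall ALG : {set N} -> {set N},
            is_greedy f k ALG \/ is_local_search f k ALG ->
            expectation_assign c
              (fun a : assignment N m =>
                 fmax f k (\bigcup_(i < m) ALG (received a i)))
            <= (1 / 2 + 1 / k%:R + eps) * fmax f k [set: N]].
Proof.
case: k hk => [//|q] _.
(* The condition [b <= M] is exactly [k * m^2 / M <= eps / 2], the bound required for missed
   blocks. *)
pose b : R := m%:R * (q.+1%:R * m%:R) * 2 / eps.
have b_ge0 : 0 <= b by rewrite /b !(mulr_ge0, invr_ge0, ler0n) // ltW.
(* The summand [q] keeps [M] above [k], so that the loss of two points per good item is absorbed by
   the [1/k] term in [half]. *)
pose n := (q + Num.bound b)%N.
have bn : b <= n.+3%:R.
  by rewrite ltW // (lt_le_trans (archi_boundP b_ge0)) // ler_nat /n; lia.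
have lower := fmax_lower R q n.
exists (item q n), (coverage_fun R (@points q n)); split.
- exact: coverage_fun_monotone.
- exact: coverage_fun_submodular.
- by exists (point q n), (@points q n); split; [exact: points_inj|].
- by apply: lt_le_trans lower; rewrite ltr0n addn_gt0.
move=> C c hC hc ALG hALG.
have ALG_sub T : ALG T \subset T.
  by case: hALG => /(_ T) []// /greedy_run_sub.
have ALG_blinded T i : blinded T -> good n i \notin ALG T.
  move=> hT; case: hALG => /(_ T) h; last exact: local_blinded hT h.
  by case: h => run card_le _; apply: greedy_blinded hT run card_le.
apply: le_trans (expected_core_set_value R hm hc ALG_sub ALG_blinded q.+1) _.
have m_gt0 : 0 < m%:R :> R by rewrite ltr0n.
have collision : C%:R ^+ 2 / m%:R <= eps / 2.
  rewrite ler_pdivrMr //.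
  have arg_ge0 : 0 <= eps * m%:R / 2 by rewrite divr_ge0 // mulr_ge0 // ltW.
  have : C%:R ^+ 2 <= Num.sqrt (eps * m%:R / 2) ^+ 2.
    by rewrite lerXn2r ?nnegrE ?sqrtr_ge0.
  by rewrite sqr_sqrtr // => /le_trans -> //; lra.
have missed : m%:R * (q.+1%:R * (m%:R / n.+3%:R)) <= eps / 2.
  rewrite !mulrA ler_pdivrMr ?ltr0n //; move: bn; rewrite /b ler_pdivrMr //.
  by lra.
have ratio_ge0 : 0 <= 1 / 2 + 1 / q.+1%:R + eps :> R.
  by rewrite !addr_ge0 ?divr_ge0 ?ltW.
apply: le_trans (ler_wpM2l ratio_ge0 lower).
apply: (@le_trans _ _ ((q.+1 * n.+3)%:R + n.+1%:R * (q%:R * eps))).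
  by rewrite lerD2l !ler_wpM2l ?ler0n // [leRHS]splitr lerD.
have half : (q.+1 * n.+3)%:R <=
    (1 / 2 + 1 / q.+1%:R) * (q.+1 * n.+3 + q * n.+1)%:R :> R.
  have -> : 1 / 2 + 1 / q.+1%:R = (q.+3)%:R / (2 * q.+1)%:R :> R.
    by rewrite addf_div ?pnatr_eq0 // !mul1r -natrD addn2 natrM.
  rewrite mulrAC ler_pdivlMr ?ltr0n // -!natrM ler_nat /n.
  (* After clearing denominators, the difference of the two sides is a polynomial with nonnegative
     coefficients. *)
  have -> : (q.+3 * (q.+1 * (q + Num.bound b).+3 + q * (q + Num.bound b).+1) =
      q.+1 * (q + Num.bound b).+3 * (2 * q.+1) +
      (q * q + 4 * q + 3 + Num.bound b * (3 * q + 1)))%N by ring.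
  exact: leq_addr.
rewrite mulrDl; apply: lerD => //.
(* The surviving fraction [eps] of the good items is charged to [eps] times the optimum, which
   includes their total value [q * n.+1]. *)
rewrite mulrA -natrM mulrC [(n.+1 * q)%N]mulnC.
by rewrite ler_wpM2l ?(ltW heps) // ler_nat leq_addl.
Qed.
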